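(* Let $\mathbf{x}\subseteq\{1,\dots,L\}$ be a configuration with $K=|\mathbf{x}|$ particles and let $N\in\{0,1,\dots,L\}$ be a particle number. Let $\bar H^K_N := \hat{\mathbf{1}}_N\, H(q,q,q^{-2K})\,\hat{\mathbf{1}}_N$ be the generator of the locally conditioned ASEP with $N$ particles and periodic boundary conditions and boundary driving strength $\bar s=-2K\ln q$. Let $|\bar\mu^N_{\mathbf{x}}\rangle := \hat{\mathbf{1}}_N|\bar\mu_{\mathbf{x}}\rangle$ be the unnormalized shock/antishock measure restricted to $N$ particles, and for $t\ge 0$ let $$|\bar\mu^N_{\mathbf{x}}(t)\rangle := \mathrm{e}^{-\bar H^K_N t}\,|\bar\mu^N_{\mathbf{x}}\rangle .$$ Then for all $t\ge 0$ $$|\bar\mu^N_{\mathbf{x}}(t)\rangle = \sum_{\mathbf{y}\in\Omega_K} \bar P^N(\mathbf{y},t|\mathbf{x},0)\,|\bar\mu^N_{\mathbf{y}}\rangle ,$$ where $\bar P^N(\mathbf{y},t|\mathbf{x},0) := \langle \mathbf{y}|\,\mathrm{e}^{-\bar H^N_K t}\,|\mathbf{x}\rangle$ with $\bar H^N_K := \hat{\mathbf{1}}_K\, H(q,q,q^{-2N})\,\hat{\mathbf{1}}_K$ is the boundary-conditioned $K$-particle transition probability from $\mathbf{x}$ to $\mathbf{y}$ at time $t$ with boundary driving strength $\bar s'=-2N\ln q$.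
   Context: Parameters: an integer $L\ge 2$ (number of sites of a ring), an asymmetry $q>0$, $q\neq 1$, a time scale $w\neq 0$, and a fugacity $z>0$. Configurations: $\eta=(\eta(1),\dots,\eta(L))\in\Omega=\{0,1\}^L$ is identified with the set $\mathbf{x}=\{k:\eta(k)=1\}$ of occupied sites, whose elements are written $x_1<\dots<x_K$ with $K=|\mathbf{x}|$. $\Omega_N$ is the set of configurations with exactly $N$ particles. To $\eta$ one assigns the basis vector $|\eta\rangle=|\eta(1))\otimes\cdots\otimes|\eta(L))$ of $(\mathbb{C}^2)^{\otimes L}$, where $|0)=(1,0)^T$ and $|1)=(0,1)^T$; $\langle\eta|$ is its transpose. $|\mathbf{x}\rangle$ denotes the same vector as $|\eta\rangle$ when $\eta$ and $\mathbf{x}$ are identified. The projector on $N$ particles is $\hat{\mathbf{1}}_N=\sum_{\eta\in\Omega_N}|\eta\rangle\langle\eta|$. One-site matrices: $\sigma^+=\begin{pmatrix}0&1\\0&0\end{pmatrix}$, $\sigma^-=\begin{pmatrix}0&0\\1&0\end{pmatrix}$, $\hat n=\begin{pmatrix}0&0\\0&1\end{pmatrix}$, $\hat\upsilon=\begin{pmatrix}1&0\\0&0\end{pmatrix}$; for a one-site matrix $u$, $u_k$ denotes $u$ acting on the $k$-th tensor factor and as the identity on the others. Weighted generator with periodic boundary conditions (for $\alpha,\beta>0$): $$H(q,\alpha,\beta)=\sum_{k=1}^{L-1}h_{k,k+1}(q,\alpha)+h_{L,1}(q,\alpha,\beta),$$ $$h_{k,k+1}(q,\alpha)=-w\left[\alpha\,\sigma^+_k\sigma^-_{k+1}-q\,\hat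 n_k\hat\upsilon_{k+1}+\alpha^{-1}\sigma^-_k\sigma^+_{k+1}-q^{-1}\hat\upsilon_k\hat n_{k+1}\right],$$ $$h_{L,1}(q,\alpha,\beta)=-w\left[\alpha\beta\,\sigma^+_L\sigma^-_{1}-q\,\hat n_L\hat\upsilon_{1}+(\alpha\beta)^{-1}\sigma^-_L\sigma^+_{1}-q^{-1}\hat\upsilon_L\hat n_{1}\right].$$ Here $\alpha=q\,\mathrm{e}^{s}$ with driving strength $s$ and $\beta=\mathrm{e}^{\bar s}$ with boundary driving strength $\bar s$. Shock/antishock measure: with $|z\rangle:=\left((1,z)^T\right)^{\otimes L}$, for a set $\mathbf{x}=\{x_1,\dots,x_K\}$, $$|\bar\mu_{\mathbf{x}}\rangle=\prod_{j=1}^K\left[z^{-1}\,q^{-\sum_{i=1}^{x_j-1}\hat n_i+\sum_{i=x_j+1}^{L}\hat n_i}\;\hat n_{x_j}\right]|z\rangle .$$ (All operators $\hat n_l$ are diagonal, so the product is unambiguous.) *)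

(* Defs.v *)
From mathcomp Require Export all_boot all_order all_algebra.
From mathcomp Require Export complex.
From mathcomp Require Export all_classical all_reals all_analysis.

Set Implicit Arguments.
Unset Strict Implicit.
Unset Printing Implicit Defensive.

Export Order.TTheory GRing.Theory Num.Theory numFieldNormedType.Exports.
Open Scope ring_scope.
Open Scope complex_scope.

(* Sites are 'I_L, i.e. 0, ..., L-1 instead of 1, ..., L. *)
Definition config (L : nat) := {ffun 'I_L -> 'I_2}.

(* The set x identified with the configuration eta. *)
Definition occ (L : nat) (eta : config L) : {set 'I_L} :=
  finset (fun k => eta k == 1).

Definition Omega (L N : nat) : {set config L} :=
  finset (fun eta : config L => #|occ eta| == N).

(* (C^2)^{(x) L} in the product basis: coordinates are indexed by
   configurations through their enumeration, so there are 2^L of them. *)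
Notation dimV L := #|{: config L}|.

Section Operators.
Variables (R : realType) (L : nat).
Local Notation C := (R[i]).
Local Notation vec := ('cV[C]_(dimV L)).
Local Notation op := ('M[C]_(dimV L)).

Definition conf (a : 'I_(dimV L)) : config L := enum_val a.

Definition tens_vec (v : 'I_L -> 'cV[C]_2) : vec :=
  \col_a \prod_(k < L) v k (conf a k) 0.

Definition tens_op (u : 'I_L -> 'M[C]_2) : op :=
  \matrix_(a, b) \prod_(k < L) u k (conf a k) (conf b k).

Definition site_op (u : 'M[C]_2) (k : 'I_L) : op :=
  tens_op (fun l => if l == k then u else 1%:M).

Definition sigma_p : 'M[C]_2 := delta_mx 0 1.
Definition sigma_m : 'M[C]_2 := delta_mx 1 0.
Definition num_op : 'M[C]_2 := delta_mx 1 1.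
Definition vac_op : 'M[C]_2 := delta_mx 0 0.

Definition ket (eta : config L) : vec :=
  tens_vec (fun k => delta_mx (eta k) 0).

Definition bra (eta : config L) : 'rV[C]_(dimV L) := (ket eta)^T.

Definition proj (N : nat) : op :=
  \sum_(eta in Omega L N) ket eta *m bra eta.

Definition expm (n : nat) (A : 'M[C]_n) : 'M[C]_n :=
  limn (series (fun k => k`!%:R^-1 *: A ^+ k)).

(* q^D for an operator D. *)
Definition qpow (q : R) (D : op) : op := expm ((ln q)%:C *: D).

Definition bond (w q alpha : R) (k l : 'I_L) : op :=
  - w%:C *: (alpha%:C *: (site_op sigma_p k *m site_op sigma_m l)
             - q%:C *: (site_op num_op k *m site_op vac_op l)
             + alpha^-1%:C *: (site_op sigma_m k *m site_op sigma_p l)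
             - q^-1%:C *: (site_op vac_op k *m site_op num_op l)).

(* ordS is the cyclic successor.  The second sum has the single term k = L-1,
   whose bond joins the last site to the first: h_{L,1}(q, alpha, beta) is the
   bulk bond operator with alpha replaced by alpha * beta. *)
Definition H (w q alpha beta : R) : op :=
  \sum_(k < L | (k.+1 < L)%N) bond w q alpha k (ordS k)
  + \sum_(k < L | k.+1 == L) bond w q (alpha * beta) k (ordS k).

(* Number of particles N, boundary driving strength - 2 M ln q. *)
Definition Hbar (w q : R) (M N : nat) : op :=
  proj N *m H w q q (q ^- (2 * M)) *m proj N.

Definition fugacity_vec (z : R) : vec :=
  tens_vec (fun=> \col_(i < 2) (z ^+ i)%:C).

Definition shock_factor (q z : R) (k : 'I_L) : op :=
  z^-1%:C *: (qpow q (- (\sum_(i < L | (i < k)%N) site_op num_op i)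
                      + \sum_(i < L | (k < i)%N) site_op num_op i)
              *m site_op num_op k).

Definition mu (q z : R) (x : config L) : vec :=
  (\prod_(k in occ x) shock_factor q z k) *m fugacity_vec z.

Definition muN (q z : R) (N : nat) (x : config L) : vec :=
  proj N *m mu q z x.

Definition muN_t (w q z : R) (N : nat) (x : config L) (t : R) : vec :=
  expm (- (t%:C *: Hbar w q #|occ x| N)) *m muN q z N x.

(* K-particle transition probability from x to y, K being the number of
   particles of x. *)
Definition Pbar (w q : R) (N : nat) (y : config L) (t : R) (x : config L) : C :=
  (bra y *m expm (- (t%:C *: Hbar w q N #|occ x|)) *m ket x) 0 0.

End Operators.

(* Main.v *)
Require Import Defs.
From mathcomp Require Import perm zify ring.

(* On the N-particle sector the shock measure is, up to the constant
   z^(N - K), the duality function D(eta, y) = [y <= eta] q^S(eta, y) with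
   S(eta, y) = sum of sgn(i - j) over i in eta, j in y.  Since S is
   antisymmetric, eta and y play symmetric roles.  Swapping the sites k and
   k + 1 of eta changes S by the occupation of these sites in y, shifted by 2K
   on the bond closing the ring (by 2N when y is moved instead), which the
   boundary weight q^(-2K) (resp. q^(-2N)) compensates exactly.  So on every
   bond the generator with weight K acting on eta and the transposed generator
   with weight N acting on y differ by (q - 1/q) D(eta, y) times the discrete
   gradient of eta - y; this telescopes around the ring.  The resulting
   intertwining of the two generators carries over to their exponentials, and
   applying it to |x> gives the claim. *)

Set Implicit Arguments.
Unset Strict Implicit.
Unset Printing Implicit Defensive.

(** * Convergence of the exponential series of real matrices, over the complex numbers *)

Section MatrixExponential.
Local Open Scope classical_set_scope.
Variable R : realType.
Local Notation C := (R[i] : numFieldType).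

Lemma cvg_real_complex (u : R^nat) (l : R) :
  u @ \oo --> l -> (u k)%:C @[k --> \oo] --> (l%:C : C).
Proof.
move=> ul; apply/(@cvgrPdist_lt _ C^o) => e e0.
(* In the order of [R[i]] a positive [e] is real, so its real part serves as the real epsilon. *)
have ereal : (complex.Re e)%:C = e by rewrite RRe_real // gtr0_real.
have Re0 : 0 < complex.Re e by rewrite -ltcR ereal.
move/cvgrPdist_lt: ul => /(_ _ Re0) h; near=> k.
rewrite -rmorphB normc_def /= expr0n addr0 sqrtr_sqr -ereal ltcR.
by near: k.
Unshelve. all: by end_near. Qed.

(** A neighbourhood of a matrix contains a product of neighbourhoods of its entries; there are
    finitely many entries, so eventually all conditions hold at once. *)
Lemma cvg_mx (T : topologicalType) (m n : nat) (u : nat -> 'M[T]_(m, n))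
    (l : 'M[T]_(m, n)) :
  (forall i j, u k i j @[k --> \oo] --> l i j) -> u @ \oo --> l.
Proof.
move=> ul A [P lP PA]; rewrite /nbhs /=.
have uP : \forall k \near \oo, forall i j, P i j (u k i j).
  apply: (filter_forall (f := fun i k => forall j, P i j (u k i j))) => i.
  apply: (filter_forall (f := fun j k => P i j (u k i j))) => j.
  exact: (ul i j _ (lP i j)).
by apply: filterS uP => k; apply: PA.
Qed.

(** The sum of all absolute entries dominates every row sum, which drives the induction. The scalar
    exponential series at this sum then majorizes each entry of the matrix series. *)
Lemma norm_expmx_entry (n : nat) (A : 'M[R]_n) (k : nat) (i j : 'I_n) :
  `|(A ^+ k) i j| <= (\sum_i \sum_j `|A i j|) ^+ k.
Proof.
set a := \sum_i _; elim: k i => [|k IH] i.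
  by rewrite !expr0 mxE; case: eqP; rewrite ?normr1 ?normr0.
have ai : \sum_l `|A i l| <= a.
  by rewrite [leRHS](bigD1 i) //= lerDl; do 2!apply: sumr_ge0 => ? _.
have a0 : 0 <= a by do 2!apply: sumr_ge0 => ? _.
rewrite !exprS mxE (le_trans (ler_norm_sum _ _ _)) //.
apply: (@le_trans _ _ (\sum_l `|A i l| * a ^+ k)).
  by apply: ler_sum => l _; rewrite normrM ler_wpM2l.
by rewrite -mulr_suml ler_wpM2r // exprn_ge0.
Qed.

Lemma series_real_complex (u : R^nat) (k : nat) :
  series (fun i => (u i)%:C : C) k = (series u k)%:C.
Proof. by rewrite /series /= rmorph_sum. Qed.

Lemma series_mx_entry (n : nat) (A : 'M[R]_n) (k : nat) (i j : 'I_n) :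
  series (fun k => k`!%:R^-1 *: map_mx (real_complex R) A ^+ k : 'M[C]_n) k i j
  = (series (fun k => k`!%:R^-1 * (A ^+ k) i j) k)%:C.
Proof.
rewrite -series_real_complex /series /= summxE; apply: eq_bigr => l _.
by rewrite mxE -rmorphXn mxE rmorphM fmorphV rmorph_nat.
Qed.

Lemma is_cvg_series_expmx_entry (n : nat) (A : 'M[R]_n) (i j : 'I_n) :
  cvgn (series (fun k => k`!%:R^-1 * (A ^+ k) i j)).
Proof.
apply: normed_cvg.
apply: (series_le_cvg (v_ := exp_coeff (\sum_i \sum_j `|A i j|)))
  => [k|k|k|] /=; first exact: normr_ge0.
- by apply: exp_coeff_ge0; do 2!apply: sumr_ge0 => ? _.
- rewrite normrM normfV normr_nat exp_coeffE ler_wpM2l //.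
  exact: norm_expmx_entry.
- exact: is_cvg_series_exp_coeff.
Qed.

(** [expm] is a [limn], so its value is usable only once convergence is known; real entries reduce
    this to real series. *)
Lemma expm_cvg (n : nat) (A : 'M[R]_n) :
  series (fun k => k`!%:R^-1 *: map_mx (real_complex R) A ^+ k) @ \oo -->
  (map_mx (real_complex R)
    (\matrix_(i, j) limn (series (fun k => k`!%:R^-1 * (A ^+ k) i j))) :
    'M[C]_n).
Proof.
apply: (@cvg_mx C) => i j; under eq_fun do rewrite series_mx_entry.
by rewrite !mxE; apply: cvg_real_complex; apply: is_cvg_series_expmx_entry.
Qed.

Lemma expmE (n : nat) (A : 'M[R]_n) :
  expm (map_mx (real_complex R) A) = map_mx (real_complex R)
    (\matrix_(i, j) limn (series (fun k => k`!%:R^-1 * (A ^+ k) i j))).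
Proof. exact: (cvg_lim (@norm_hausdorff C (matrix C n n)) (@expm_cvg n A)). Qed.

Lemma expm_entry_cvg (n : nat) (A : 'M[R]_n) (i j : 'I_n) :
  series (fun k => k`!%:R^-1 *: map_mx (real_complex R) A ^+ k) k i j
    @[k --> \oo] --> (expm (map_mx (real_complex R) A) i j : C).
Proof.
apply: (@continuous_cvg _ _ _ _ _ _ (fun M : 'M[C]_n => M i j)).
  exact: (@coord_continuous C).
by rewrite expmE; exact: expm_cvg.
Qed.

Lemma expm_diag (n : nat) (d : 'rV[R]_n) :
  expm (map_mx (real_complex R) (diag_mx d)) =
  map_mx (real_complex R) (diag_mx (map_mx expR d)).
Proof.
rewrite expmE; congr map_mx; apply/matrixP => i j; rewrite !mxE.
have dX k : diag_mx d ^+ k = diag_mx (\row_i d 0 i ^+ k).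
  elim: k => [|k IH].
    by apply/matrixP => a b; rewrite expr0 !mxE expr0.
  rewrite exprS IH [_ * _]mulmx_diag; congr diag_mx.
  by apply/rowP => a; rewrite !mxE exprS.
under eq_fun do rewrite dX !mxE.
have [_|_] := eqVneq i j.
  by rewrite /expR exp_coeffE.
rewrite (_ : series _ = cst 0) ?lim_cst //.
by apply/funext => k; rewrite /series /= big1 // => l _; rewrite mulr0n mulr0.
Qed.

(* The commutation relation passes to every power, hence to the partial sums
   of the exponential series and to their entrywise limits. *)
Lemma expm_intertwine (m n : nat) (A : 'M[R]_m) (B : 'M[R]_n)
    (M : 'M[C]_(m, n)) :
  map_mx (real_complex R) A *m M = M *m map_mx (real_complex R) B ->
  expm (map_mx (real_complex R) A) *m M = M *m expm (map_mx (real_complex R) B).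
Proof.
set Ac := map_mx _ A; set Bc := map_mx _ B => AM.
have AMX k : Ac ^+ k *m M = M *m Bc ^+ k.
  elim: k => [|k IH]; first by rewrite !expr0 mul1mx mulmx1.
  rewrite !exprSr -[_ * Ac]/(_ *m _) -[_ * Bc]/(_ *m _).
  by rewrite -mulmxA AM mulmxA IH -mulmxA.
pose eA := series (fun k => k`!%:R^-1 *: Ac ^+ k).
pose eB := series (fun k => k`!%:R^-1 *: Bc ^+ k).
have AMS k : eA k *m M = M *m eB k.
  rewrite /eA /eB /series /= mulmx_suml mulmx_sumr; apply: eq_bigr => l _.
  by rewrite -scalemxAl AMX scalemxAr.
apply/matrixP => i j.
have cA : (eA k *m M) i j @[k --> \oo] --> ((expm Ac *m M) i j : C).
  under eq_fun do rewrite mxE; rewrite mxE.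
  apply: (@cvg_big C) => [|l _]; first exact: (@add_continuous C^o).
  by apply: (@cvgM C); [exact: expm_entry_cvg | exact: cvg_cst].
have cB : (M *m eB k) i j @[k --> \oo] --> ((M *m expm Bc) i j : C).
  under eq_fun do rewrite mxE; rewrite mxE.
  apply: (@cvg_big C) => [|l _]; first exact: (@add_continuous C^o).
  by apply: (@cvgM C); [exact: cvg_cst | exact: expm_entry_cvg].
have limE := cvg_lim (@norm_hausdorff C C^o).
rewrite -(limE _ _ _ _ _ cA) -(limE _ _ _ _ _ cB).
by under eq_fun do rewrite AMS.
Qed.

End MatrixExponential.

(** * Duality of the two generators, as an identity between rates *)

Section Duality.
Variables (R : realType) (L : nat).
Local Notation config := (config L).
Implicit Types (eta y : config) (k l m i j : 'I_L) (q : R).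

Lemma ord2P (a : 'I_2) : nat_of_ord a = 0%N \/ nat_of_ord a = 1%N.
Proof. by case: a => [[|[|//]] ?]; [left | right]. Qed.

Definition swap k l eta : config := [ffun m => eta (tperm k l m)].

Lemma swapK k l : involutive (swap k l).
Proof. by move=> eta; apply/ffunP => m; rewrite !ffunE tpermK. Qed.

Lemma sum_swap (V : nmodType) k l eta (F : nat -> 'I_L -> V) :
  \sum_i F (swap k l eta i) i = \sum_i F (eta i) (tperm k l i).
Proof.
rewrite (reindex_inj (@perm_inj _ (tperm k l))); apply: eq_bigr => i _.
by rewrite ffunE tpermK.
Qed.

Lemma card_occ eta : #|occ eta| = (\sum_i eta i)%N.
Proof.
rewrite -sum1_card big_mkcond; apply: eq_bigr => i _; rewrite inE.
by case: (eta i) => [[|[|//]]] /=.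
Qed.

Lemma mem_Omega N eta : (eta \in Omega L N) = (#|occ eta| == N).
Proof. by rewrite inE. Qed.

Lemma card_occ_swap k l eta : #|occ (swap k l eta)| = #|occ eta|.
Proof.
rewrite !card_occ; exact: (sum_swap (V := nat) k l eta (fun a _ => a)).
Qed.

Definition sgnd (i j : nat) : int := (j < i)%:Z - (i < j)%:Z.

Lemma sgndC i j : sgnd i j = - sgnd j i.
Proof. by rewrite /sgnd opprB. Qed.

(** The exponent S(eta, y): each particle of [y] counts the particles of [eta] to its right minus
    those to its left. *)
Definition winding eta y : int :=
  \sum_i \sum_j ((eta i)%:Z * (y j)%:Z * sgnd i j).

Lemma windingC eta y : winding eta y = - winding y eta.
Proof.
rewrite /winding exchange_big -sumrN; apply: eq_bigr => i _.
rewrite -sumrN; apply: eq_bigr => j _.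
by rewrite sgndC mulrN [_ * (y i)%:Z]mulrC.
Qed.

(** A step to the right raises the sign by one at its two end sites only. The step closing the ring
    goes from the last site back to site 0, which costs a further 2 for every [j]. *)
Lemma sgnd_ordS k j :
  sgnd (ordS k) j - sgnd k j
  = (j == k)%:Z + (j == ordS k)%:Z - 2 * (k.+1 == L)%:Z.
Proof.
have := ltn_ord k; have := ltn_ord j.
rewrite -!val_eqE /sgnd /=; case: (eqVneq k.+1 L) => [e|ne] jL kL.
  rewrite e modnn; lia.
rewrite modn_small; last by lia.
lia.
Qed.

(** [winding] is linear in [eta] with coefficients [T], so the exchange contributes the difference
    of occupations times [T l - T k]. Summing [sgnd_ordS] over the particles of [y] gives that
    difference; its closing term counts all of them. *)
Lemma winding_swap k eta y : k != ordS k ->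
  winding (swap k (ordS k) eta) y = winding eta y
  + ((eta k)%:Z - (eta (ordS k))%:Z)
    * ((y k)%:Z + (y (ordS k))%:Z - 2 * (k.+1 == L)%:Z * #|occ y|%:Z).
Proof.
move=> kl; set l := ordS k; pose T i := \sum_j (y j)%:Z * sgnd i j.
have windE xi : winding xi y = \sum_i (xi i)%:Z * T i.
  apply: eq_bigr => i _; rewrite mulr_sumr.
  by apply: eq_bigr => j _; rewrite mulrA.
have Tlk : T l - T k
    = (y k)%:Z + (y l)%:Z - 2 * (k.+1 == L)%:Z * #|occ y|%:Z.
  rewrite /T -sumrB.
  under eq_bigr do rewrite -mulrBr sgnd_ordS mulrBr mulrDr.
  rewrite sumrB big_split /=; congr (_ + _ - _).
  - rewrite (bigD1 k) //= eqxx mulr1 big1 ?addr0 // => j /negbTE ->.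
    by rewrite mulr0.
  - rewrite (bigD1 l) //= eqxx mulr1 big1 ?addr0 // => j /negbTE ->.
    by rewrite mulr0.
  - rewrite -mulr_suml mulrC card_occ; congr (_ * _).
    by rewrite -[RHS]natz natr_sum; apply: eq_bigr => j _; rewrite natz.
rewrite -Tlk windE (sum_swap k l eta (fun a i => (a : nat)%:Z * T i)) windE.
apply/eqP; rewrite addrC -subr_eq -sumrB; apply/eqP.
under eq_bigr do rewrite -mulrBr.
rewrite (bigD1 k) //= (bigD1 l) /=; last by rewrite eq_sym.
rewrite tpermL tpermR big1 => [|i /andP[ik il]]; first by ring.
by rewrite tpermD 1?eq_sym // subrr mulr0.
Qed.

Lemma winding_swapr k eta y : k != ordS k ->
  winding eta (swap k (ordS k) y) = winding eta y
  - ((y k)%:Z - (y (ordS k))%:Z)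
    * ((eta k)%:Z + (eta (ordS k))%:Z - 2 * (k.+1 == L)%:Z * #|occ eta|%:Z).
Proof.
by move=> kl; rewrite windingC winding_swap // opprD -windingC.
Qed.

Definition below eta y := [forall m, (y m <= eta m)%N].

(** The part of [below] that an exchange of [k] and [l] leaves unchanged; the rest depends on four
    occupation numbers only. *)
Definition below_away k l eta y :=
  [forall m, [|| m == k, m == l | (y m <= eta m)%N]].

Lemma below_split k l eta y :
  below eta y = [&& (y k <= eta k)%N, (y l <= eta l)%N & below_away k l eta y].
Proof.
apply/forallP/and3P => [le_y|[yk yl /forallP le_y] m].
  by split=> //; apply/forallP => m; rewrite le_y !orbT.
by have /or3P[/eqP->|/eqP->|] := le_y m.
Qed.

Lemma below_swapl k l eta y : k != l ->
  below (swap k l eta) y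
  = [&& (y k <= eta l)%N, (y l <= eta k)%N & below_away k l eta y].
Proof.
move=> kl; rewrite (below_split k l) !ffunE tpermL tpermR; congr [&& _, _ & _].
apply: eq_forallb => m; rewrite ffunE; have [//|mk] := eqVneq m k.
by have [//|ml] := eqVneq m l; rewrite tpermD // eq_sym.
Qed.

Lemma below_swapr k l eta y : k != l ->
  below eta (swap k l y)
  = [&& (y l <= eta k)%N, (y k <= eta l)%N & below_away k l eta y].
Proof.
move=> kl; rewrite (below_split k l) !ffunE tpermL tpermR; congr [&& _, _ & _].
apply: eq_forallb => m; rewrite ffunE; have [//|mk] := eqVneq m k.
by have [//|ml] := eqVneq m l; rewrite tpermD // eq_sym.
Qed.

Definition duality q eta y : R := (below eta y)%:R * q ^ winding eta y.

(* [bond_act] is the bond generator without its factor [- w] acting on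
   functions of the configuration, [bond_act_tr] its transpose. *)
Definition bond_act q al k l (F : config -> R) eta : R :=
  (eta l)%:R * (1 - (eta k)%:R) * (al * F (swap k l eta) - q^-1 * F eta)
  + (eta k)%:R * (1 - (eta l)%:R) * (al^-1 * F (swap k l eta) - q * F eta).

Definition bond_act_tr q al k l (F : config -> R) y : R :=
  (y k)%:R * (1 - (y l)%:R) * (al * F (swap k l y) - q * F y)
  + (y l)%:R * (1 - (y k)%:R) * (al^-1 * F (swap k l y) - q^-1 * F y).

(** The weight alpha of bond [k], replaced by alpha * beta on the bond closing the ring; in the
    duality, [M] is the particle number of the other configuration. *)
Definition ring_rate q k (M : nat) : R :=
  if k.+1 == L then q * q ^- (2 * M) else q.

(** A single bond is not dual on its own: even with no particle of [y] on it, a lone particle of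
    [eta] hops with effective weight q^-1 or q against the escape rate q or q^-1. The gradient
    records this mismatch. *)
Lemma bond_duality q k eta y : 0 < q -> k != ordS k ->
  bond_act q (ring_rate q k #|occ y|) k (ordS k) (duality q ^~ y) eta
  - bond_act_tr q (ring_rate q k #|occ eta|) k (ordS k) (duality q eta) y
  = (q - q^-1) * duality q eta y
    * (((eta (ordS k))%:R - (eta k)%:R) - ((y (ordS k))%:R - (y k)%:R)).
Proof.
move=> q0 kl; set l := ordS k.
have qn0 : q != 0 by rewrite gt_eqF.
(* The boundary weight, isolated so that it can be cancelled. *)
pose c M : R := if k.+1 == L then q ^- (2 * M) else 1.
have cn0 M : c M != 0.
  by rewrite /c; case: ifP => _; rewrite ?oner_eq0 ?invr_eq0 ?expf_neq0.
have rE M : ring_rate q k M = q * c M.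
  by rewrite /ring_rate /c; case: ifP => _; rewrite ?mulr1.
(* An exchange multiplies q^S by a power in which the same [c M] occurs, with the sign of the
   exponent opposite to that in the rate of the hop. *)
have cE (u v M : nat) (d : int) :
    q ^ (d * (u%:Z + v%:Z - 2 * (k.+1 == L)%:Z * M%:Z))
    = (q ^+ u * q ^+ v * c M) ^ d.
  rewrite mulrC -exprz_exp !expfzDr // -!exprnP; congr ((_ * _) ^ _).
  rewrite /c; case: eqP => _ /=; last by rewrite mulr0 mul0r oppr0 expr0z.
  by rewrite mulr1 exprnN PoszM.
rewrite /bond_act /bond_act_tr /duality !rE.
rewrite (below_swapl _ _ kl) (below_swapr _ _ kl) (below_split k l).
rewrite winding_swapr // winding_swap // -/l -[- (((y k)%:Z - _) * _)]mulNr.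
rewrite ![q ^ (winding _ _ + _)]expfzDr // !cE opprB.
(* Everything nonlocal is now a generic parameter; a rational identity remains for each choice of
   the four local occupation numbers. *)
move: (q ^ winding eta y) (below_away _ _ _ _) (c _) (cn0 #|occ eta|)
  (c _) (cn0 #|occ y|) => X r cN cN0 cK cK0.
have [->|->] := ord2P (eta k); have [->|->] := ord2P (eta l);
have [->|->] := ord2P (y k); have [->|->] := ord2P (y l);
rewrite !(subrr, subr0, sub0r) ?(expr0z, expr1z, exprN1, expr0, expr1)
  ?(mul0r, mulr0, mul1r, mulr1, addr0, add0r, oppr0) /=.
all: by case: r; rewrite ?mulr1n ?mulr0n; field; rewrite ?qn0 ?cN0 ?cK0.
Qed.

(** Row [eta], column [xi] of the bond operator divided by [- w]; the four terms follow those of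
    [bond]. *)
Definition bond_rate q al k l eta xi : R :=
  al * ((eta l)%:R * (1 - (eta k)%:R)) * (xi == swap k l eta)%:R
  - q * ((eta k)%:R * (1 - (eta l)%:R)) * (xi == eta)%:R
  + al^-1 * ((eta k)%:R * (1 - (eta l)%:R)) * (xi == swap k l eta)%:R
  - q^-1 * ((eta l)%:R * (1 - (eta k)%:R)) * (xi == eta)%:R.

Lemma sum_pred1 (T : finType) (t : T) (F : T -> R) :
  \sum_x (x == t)%:R * F x = F t.
Proof.
rewrite (bigD1 t) //= eqxx mul1r big1 ?addr0 // => x /negbTE ->.
by rewrite mul0r.
Qed.

Lemma bond_actE q al k l (F : config -> R) eta :
  \sum_xi bond_rate q al k l eta xi * F xi = bond_act q al k l F eta.
Proof.
rewrite /bond_rate.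
under eq_bigr do rewrite !mulrDl !mulNr -!mulrA.
rewrite !big_split /= !sumrN -!mulr_sumr !sum_pred1 /bond_act; ring.
Qed.

Lemma bond_act_trE q al k l (F : config -> R) y :
  \sum_xi F xi * bond_rate q al k l xi y = bond_act_tr q al k l F y.
Proof.
pose G1 xi := F xi * (al * ((xi l)%:R * (1 - (xi k)%:R))
  + al^-1 * ((xi k)%:R * (1 - (xi l)%:R))).
pose G2 xi := F xi * (- (q * ((xi k)%:R * (1 - (xi l)%:R)))
  - q^-1 * ((xi l)%:R * (1 - (xi k)%:R))).
(* The exchange is an involution, so column [y] only meets the rows [swap k l y] and [y]. *)
transitivity (\sum_xi ((xi == swap k l y)%:R * G1 xi + (xi == y)%:R * G2 xi)).
  apply: eq_bigr => xi _; rewrite /bond_rate /G1 /G2 [y == xi]eq_sym.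
  rewrite (_ : (y == swap k l xi) = (xi == swap k l y)); first by ring.
  by rewrite -(inj_eq (inv_inj (swapK k l))) swapK eq_sym.
rewrite big_split /= !sum_pred1 /G1 /G2 /bond_act_tr !ffunE tpermL tpermR.
ring.
Qed.

Definition ring_rates q M eta xi : R :=
  \sum_k bond_rate q (ring_rate q k M) k (ordS k) eta xi.

Lemma ordS_neq k : (2 <= L)%N -> k != ordS k.
Proof.
move=> L2; apply/eqP => /(congr1 val) /=; have := ltn_ord k.
have [e|ne] := eqVneq k.+1 L; first by rewrite e modnn; lia.
by move=> kL; rewrite modn_small; lia.
Qed.

(** The factor in front of the gradient in [bond_duality] is the same for all bonds, and [ordS]
    permutes the sites, so the gradients sum to zero. *)
Lemma ring_duality q eta y : 0 < q -> (2 <= L)%N ->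
  \sum_xi ring_rates q #|occ y| eta xi * duality q xi y
  = \sum_xi duality q eta xi * ring_rates q #|occ eta| xi y.
Proof.
move=> q0 L2; rewrite /ring_rates.
under eq_bigr do rewrite mulr_suml.
under [RHS]eq_bigr do rewrite mulr_sumr.
rewrite exchange_big [RHS]exchange_big /=.
under eq_bigr do rewrite bond_actE.
under [RHS]eq_bigr do rewrite bond_act_trE.
apply/eqP; rewrite -subr_eq0 -sumrB.
under eq_bigr do rewrite bond_duality ?ordS_neq //.
have telescope (xi : config) : \sum_k ((xi (ordS k))%:R - (xi k)%:R) = 0 :> R.
  by rewrite sumrB [X in _ - X](reindex_inj (@ordS_inj L)) subrr.
by rewrite -mulr_sumr sumrB !telescope subrr mulr0.
Qed.

(** Particle conservation, which lets sums cut down by a projector be extended to all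
    configurations. *)
Lemma ring_rates_occ q M eta xi :
  #|occ eta| != #|occ xi| -> ring_rates q M eta xi = 0.
Proof.
move=> ne; rewrite /ring_rates big1 // => k _; rewrite /bond_rate.
have /negbTE -> : xi != swap k (ordS k) eta.
  by apply: contraNneq ne => ->; rewrite card_occ_swap.
have /negbTE -> : xi != eta by apply: contraNneq ne => ->.
by rewrite !mulr0 !subr0 addr0.
Qed.

End Duality.

(** * Matrix entries of the generator in the configuration basis *)

Section Operators.
Variables (R : realType) (L : nat).
Local Notation C := (R[i]).
Local Notation config := (config L).
Local Notation dim := (dimV L).
Implicit Types (eta xi y : config) (k l : 'I_L) (a b : 'I_dim).

Lemma conf_inj : injective (@conf L).
Proof. exact: enum_val_inj. Qed.

Lemma conf_rank eta : conf (enum_rank eta) = eta.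
Proof. exact: enum_rankK. Qed.

Lemma sum_conf (V : nmodType) (F : config -> V) :
  \sum_a F (conf a) = \sum_eta F eta.
Proof.
rewrite (reindex (@enum_rank config)); last first.
  by exists (@conf L) => x _; [exact: enum_rankK | exact: enum_valK].
by apply: eq_bigr => eta _; rewrite conf_rank.
Qed.

Lemma prod_natb (I : finType) (T : comPzSemiRingType) (F : pred I) :
  \prod_i (F i)%:R = [forall i, F i]%:R :> T.
Proof.
have [/forallP allF|/forallPn[x /negbTE nFx]] := boolP [forall i, F i].
  by rewrite big1 // => x _; rewrite allF.
by rewrite (bigD1 x) //= nFx mul0r.
Qed.

Lemma ketE eta a : ket R eta a 0 = (conf a == eta)%:R.
Proof.
rewrite mxE; under eq_bigr do rewrite mxE andbT.
rewrite prod_natb; congr (nat_of_bool _)%:R.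
apply/forallP/eqP => [e|-> //].
by apply/ffunP => k; apply/eqP; exact: e.
Qed.

(** The only column in which row [eta] of the site operator [delta_mx s t] at [k] can be nonzero. *)
Definition upd eta k (t : 'I_2) : config :=
  [ffun m => if m == k then t else eta m].

Lemma site_op_deltaE (s t : 'I_2) k a b :
  site_op (delta_mx s t : 'M[C]_2) k a b
  = ((conf a k == s) && (conf b == upd (conf a) k t))%:R.
Proof.
rewrite mxE (eq_bigr (fun m => ((if m == k
  then (conf a k == s) && (conf b k == t)
  else conf a m == conf b m)%:R))); last first.
  by move=> m _; case: eqP => [->|_]; rewrite mxE.
rewrite prod_natb; congr (nat_of_bool _)%:R.
apply/forallP/andP => [e|[ak /eqP -> m]].
  have := e k; rewrite eqxx => /andP[-> /eqP bk]; split=> //.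
  apply/eqP/ffunP => m; rewrite ffunE; have := e m.
  by case: eqP => [->|_ /eqP ->].
by rewrite !ffunE eqxx ak eqxx; case: eqP.
Qed.

Lemma site_op2E (s t s' t' : 'I_2) k l a b : k != l ->
  (site_op (delta_mx s t : 'M[C]_2) k
    *m site_op (delta_mx s' t' : 'M[C]_2) l) a b
  = [&& conf a k == s, conf a l == s'
      & conf b == upd (upd (conf a) k t) l t']%:R.
Proof.
move=> kl; rewrite mxE.
under eq_bigr do rewrite !site_op_deltaE.
pose F xi : C := ((conf a k == s) && (xi == upd (conf a) k t))%:R
  * ((xi l == s') && (conf b == upd xi l t'))%:R.
rewrite (sum_conf F) (bigD1 (upd (conf a) k t)) //= big1 => [|xi /negbTE ne].
  by rewrite /F eqxx andbT addr0 -natrM mulnb ffunE [l == k]eq_sym (negbTE kl).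
by rewrite /F ne andbF mul0r.
Qed.

Lemma ord2_eq1 (s : 'I_2) : (s == 1)%:R = s%:R :> R.
Proof. by case: s => [[|[|//]]]. Qed.

Lemma ord2_eq0 (s : 'I_2) : (s == 0)%:R = 1 - s%:R :> R.
Proof. by case: s => [[|[|//]]] /= i; rewrite ?subr0 ?subrr. Qed.

Lemma upd_swap k l eta : k != l ->
  upd (upd eta k (eta l)) l (eta k) = swap k l eta.
Proof.
move=> kl; apply/ffunP => m; rewrite !ffunE.
have [->|ml] := eqVneq m l; first by rewrite tpermR.
have [->|mk] := eqVneq m k; first by rewrite tpermL.
by rewrite tpermD // eq_sym.
Qed.

Lemma upd_id k l eta : upd (upd eta k (eta k)) l (eta l) = eta.
Proof.
apply/ffunP => m; rewrite !ffunE; have [->//|_] := eqVneq m l.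
by have [->|_] := eqVneq m k.
Qed.

Lemma hop_opE (s t : 'I_2) k l a b : k != l ->
  (site_op (delta_mx s t : 'M[C]_2) k *m site_op (delta_mx t s : 'M[C]_2) l) a b
  = ([&& conf a k == s, conf a l == t & conf b == swap k l (conf a)]%:R : R)%:C.
Proof.
move=> kl; rewrite site_op2E // rmorph_nat.
have [<-|//] := eqVneq (conf a k) s; have [<-|//] := eqVneq (conf a l) t.
by rewrite upd_swap.
Qed.

Lemma diag_opE (s t : 'I_2) k l a b : k != l ->
  (site_op (delta_mx s s : 'M[C]_2) k *m site_op (delta_mx t t : 'M[C]_2) l) a b
  = ([&& conf a k == s, conf a l == t & conf b == conf a]%:R : R)%:C.
Proof.
move=> kl; rewrite site_op2E // rmorph_nat.
have [<-|//] := eqVneq (conf a k) s; have [<-|//] := eqVneq (conf a l) t.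
by rewrite upd_id.
Qed.

Lemma bondE (w q al : R) k l a b : k != l ->
  bond w q al k l a b = (- w * bond_rate q al k l (conf a) (conf b))%:C.
Proof.
move=> kl; rewrite /bond /sigma_p /sigma_m /num_op /vac_op.
move: (hop_opE 0 1 a b kl) (hop_opE 1 0 a b kl).
move: (diag_opE 0 1 a b kl) (diag_opE 1 0 a b kl).
move: (_ *m _) (_ *m _) (_ *m _) (_ *m _) => D1 D2 D3 D4 E1 E2 E3 E4.
rewrite !mxE E1 E2 E3 E4 /bond_rate -!ord2_eq0 -!ord2_eq1.
have andbR (x y z : bool) : [&& x, y & z]%:R = x%:R * y%:R * z%:R :> R.
  by rewrite -!natrM !mulnb andbA.
rewrite !andbR !(rmorphM, rmorphN, rmorphB, rmorphD) /=.
ring.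
Qed.

Lemma HE (w q : R) (M : nat) a b : (2 <= L)%N ->
  H L w q q (q ^- (2 * M)) a b = (- w * ring_rates q M (conf a) (conf b))%:C.
Proof.
move=> L2; rewrite /ring_rates mulr_sumr rmorph_sum.
rewrite [RHS](bigID (fun k : 'I_L => k.+1 < L)%N) /H [LHS]mxE /=.
congr (_ + _); rewrite summxE.
  by apply: eq_bigr => k kL; rewrite bondE ?ordS_neq // /ring_rate ltn_eqF.
apply: eq_big => [k|k kL]; first by rewrite -leqNgt eqn_leq ltn_ord.
by rewrite bondE ?ordS_neq // /ring_rate kL.
Qed.

Lemma bra_ketE eta a b :
  (ket R eta *m bra R eta) a b = (conf a == eta)%:R * (conf b == eta)%:R.
Proof. by rewrite mxE big_ord1 ketE /bra [_^T 0 b]mxE ketE. Qed.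

Lemma projE N a b : proj R L N a b = ((a == b) && (conf a \in Omega L N))%:R.
Proof.
rewrite summxE; under eq_bigr do rewrite bra_ketE.
have [aN|aN] := boolP (conf a \in Omega L N); last first.
  rewrite andbF big1 // => eta etaN; case: eqP => [ae|]; last by rewrite mul0r.
  by rewrite ae etaN in aN.
rewrite (bigD1 (conf a)) // eqxx mul1r big1 => [|eta /andP[_ /negbTE ne]].
  by rewrite /= addr0 andbT (inj_eq conf_inj) eq_sym.
by rewrite eq_sym ne mul0r.
Qed.

Lemma proj_diag N :
  proj R L N = diag_mx (\row_a (conf a \in Omega L N)%:R).
Proof.
by apply/matrixP => a b; rewrite projE !mxE; case: eqP; rewrite ?mulr0n ?mulr1n.
Qed.

(** The generator has real entries; the results on [expm] are stated for complexified real
    matrices. *)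
Definition Hbar_real (w q : R) (M N : nat) : 'M[R]_dim :=
  \matrix_(a, b) ((conf a \in Omega L N)%:R * (conf b \in Omega L N)%:R
                  * (- w * ring_rates q M (conf a) (conf b))).

Lemma HbarE (w q : R) (M N : nat) : (2 <= L)%N ->
  Hbar L w q M N = map_mx (real_complex R) (Hbar_real w q M N).
Proof.
move=> L2; apply/matrixP => a b.
rewrite /Hbar proj_diag; move: (HE w q M a b L2); move: (H _ _ _ _ _) => h hE.
rewrite mul_mx_diag mul_diag_mx !mxE hE !(rmorphM, rmorphN) /= !rmorph_nat.
by rewrite mulrAC.
Qed.

(** * Entries of the shock measure *)

Lemma num_op_diag k :
  site_op (num_op R) k
  = map_mx (real_complex R) (diag_mx (\row_a (conf a k)%:R)).
Proof.
apply/matrixP => a b.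
rewrite /num_op site_op_deltaE !mxE rmorphMn /= rmorph_nat.
have [ak|ak] := ord2P (conf a k).
  have /negbTE -> : conf a k != 1 by rewrite -val_eqE /= ak.
  by rewrite /= ak mul0rn.
have ak1 : conf a k = 1 by exact/val_inj.
rewrite ak1 eqxx /=; congr (nat_of_bool _)%:R.
have -> : upd (conf a) k 1 = conf a.
  by apply/ffunP => m; rewrite ffunE; case: eqP => [->|//]; rewrite ak1.
by rewrite (inj_eq conf_inj) eq_sym.
Qed.

Lemma sum_num_op (P : pred 'I_L) :
  \sum_(i | P i) site_op (num_op R) i = map_mx (real_complex R)
    (diag_mx (\row_a \sum_(i | P i) (conf a i)%:R)).
Proof.
under eq_bigr do rewrite num_op_diag.
apply/matrixP => a b; rewrite summxE !mxE -sumrMnl rmorph_sum.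
by apply: eq_bigr => i _; rewrite !mxE.
Qed.

Lemma expR_lnM (q : R) (n : int) : 0 < q -> expR (ln q * n%:~R) = q ^ n.
Proof.
move=> q0; case: n => n; first by rewrite mulrC expRM_natl lnK // posrE.
by rewrite NegzE mulrNz mulrN expRN mulrC expRM_natl lnK ?posrE // exprnN.
Qed.

(** Particles left of [k] count -1 and those right of it +1, so the exponent is the inner sum of
    [winding] for one particle at [k]. *)
Lemma shock_factor_diag (q z : R) k : 0 < q ->
  shock_factor q z k = map_mx (real_complex R) (diag_mx
    (\row_a (z^-1 * q ^ (\sum_i (conf a i)%:Z * sgnd i k) * (conf a k)%:R))).
Proof.
move=> q0; rewrite /shock_factor /qpow.
set D := - _ + _.
have -> : (ln q)%:C *: D = map_mx (real_complex R) (diag_mx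
    (\row_a (ln q * (\sum_i (conf a i)%:Z * sgnd i k)%:~R))).
  have -> : D = map_mx (real_complex R) (diag_mx
      (\row_a (\sum_i (conf a i)%:Z * sgnd i k)%:~R)).
    rewrite /D !sum_num_op -map_mxN -map_mxD -raddfN -raddfD.
    congr (map_mx _ (diag_mx _)); apply/rowP => a; rewrite !mxE.
    rewrite big_mkcond [X in _ + X]big_mkcond -sumrN -big_split rmorph_sum.
    apply: eq_bigr => i _; rewrite rmorphM /sgnd rmorphB /=.
    by case: ltngtP => _; rewrite ?subrr ?sub0r ?subr0 ?mulr0 ?mulrN ?mulr1
       ?oppr0 ?addr0 ?add0r.
  apply/matrixP => a b; rewrite !mxE -rmorphM /=; congr _%:C.
  by rewrite -mulrnAr.
rewrite expm_diag num_op_diag -map_mxM mulmx_diag -map_mxZ.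
congr map_mx; apply/matrixP => a b; rewrite !mxE -mulrA.
by rewrite expR_lnM //; exact: mulrnAr.
Qed.

Lemma prod_diag_mx (T : comPzSemiRingType) (n : nat) (I : Type) (r : seq I)
    (P : pred I) (d : I -> 'rV[T]_n) :
  \prod_(i <- r | P i) diag_mx (d i)
  = diag_mx (\row_a \prod_(i <- r | P i) d i 0 a).
Proof.
elim: r => [|i r IH].
  by rewrite big_nil; apply/matrixP => a b; rewrite !mxE big_nil.
rewrite big_cons IH; case: ifP => Pi; last first.
  by congr diag_mx; apply/rowP => a; rewrite !mxE big_cons Pi.
rewrite [_ * _]mulmx_diag; congr diag_mx; apply/rowP => a.
by rewrite !mxE big_cons Pi.
Qed.

Lemma fugacityE (z : R) a :
  fugacity_vec L z a 0 = (z ^+ #|occ (conf a)|)%:C.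
Proof.
rewrite mxE card_occ expr_sum rmorph_prod; apply: eq_bigr => k _.
by rewrite mxE.
Qed.

Lemma prod_occ (V : comPzSemiRingType) y (F : 'I_L -> V) :
  \prod_(k in occ y) F k = \prod_k F k ^+ (y k).
Proof.
rewrite big_mkcond; apply: eq_bigr => k _; rewrite inE.
have [yk|yk] := ord2P (y k).
  have /negbTE -> : y k != 1 by rewrite -val_eqE /= yk.
  by rewrite yk.
have -> : y k = 1 by exact/val_inj.
by rewrite eqxx.
Qed.

(** All factors are diagonal. Each particle of [y] brings one z^-1, a number operator and a power of
    q: the number operators multiply to [below], and the exponents add up to [winding]. *)
Lemma muE (q z : R) y a : 0 < q ->
  mu q z y a 0
  = (z^-1 ^+ #|occ y| * z ^+ #|occ (conf a)| * duality q (conf a) y)%:C.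
Proof.
move=> q0; rewrite /mu (eq_bigr _ (fun k _ => shock_factor_diag z k q0)).
rewrite -rmorph_prod prod_diag_mx /= map_diag_mx mul_diag_mx.
move: (fugacityE z a); move: (fugacity_vec _ _) => f fE.
rewrite !mxE fE -rmorphM; congr _%:C.
under eq_bigr do rewrite mxE.
rewrite !big_split /= prodr_const -!mulrA; congr (_ * _).
rewrite mulrA mulrC; congr (_ * _); rewrite mulrC /duality; congr (_ * _).
  rewrite prod_occ -prod_natb; apply: eq_bigr => k _.
  by have [->|->] := ord2P (y k); have [->|->] := ord2P (conf a k).
have prodE (F : 'I_L -> int) : \prod_k q ^ F k = q ^ (\sum_k F k).
  have qD (u v : int) : q ^ (u + v) = q ^ u * q ^ v.
    by rewrite expfzDr // lt0r_neq0.
  exact/esym/(big_morph (exprz q) qD (expr0z q)).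
rewrite prod_occ /winding exchange_big -prodE; apply: eq_bigr => j _.
rewrite exprnP exprz_exp mulr_suml; congr (_ ^ _); apply: eq_bigr => i _.
by rewrite mulrAC.
Qed.

(** * The kernel with the shock measures as columns, and its intertwining property *)

Definition shock_kernel (q z : R) (K N : nat) : 'M[C]_dim :=
  \sum_(y in Omega L K) muN q z N y *m bra R y.

Lemma bra_mul_ket y y' : bra R y' *m ket R y = (y' == y)%:R%:M.
Proof.
apply/matrixP => i j; rewrite !ord1 mxE [RHS]mxE eqxx mulr1n /bra.
rewrite (eq_bigr (fun a => (conf a == y')%:R * (conf a == y)%:R)) => [|a _].
  rewrite (sum_conf (fun xi => (xi == y')%:R * (xi == y)%:R)).
  rewrite (bigD1 y') //= eqxx mul1r big1 ?addr0 // => xi /negbTE ->.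
  by rewrite mul0r.
by rewrite mxE !ketE.
Qed.

Lemma shock_kernel_ket (q z : R) (K N : nat) y :
  y \in Omega L K -> shock_kernel q z K N *m ket R y = muN q z N y.
Proof.
move=> yK; rewrite /shock_kernel mulmx_suml (bigD1 y) //=.
rewrite big1 => [|y' /andP[_]].
  by rewrite addr0 -mulmxA bra_mul_ket eqxx mulmx1.
by move=> /negbTE ne; rewrite -mulmxA bra_mul_ket ne mul_mx_scalar scale0r.
Qed.

(** On the two sectors the powers of z in [muE] are constant, so the kernel is a multiple of
    [duality] there. *)
Lemma shock_kernelE (q z : R) (K N : nat) a b : 0 < q ->
  shock_kernel q z K N a b
  = ((conf a \in Omega L N)%:R * (conf b \in Omega L K)%:R
     * (z^-1 ^+ K * z ^+ N * duality q (conf a) (conf b)))%:C.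
Proof.
move=> q0; rewrite /shock_kernel summxE.
have termE y : (muN q z N y *m bra R y) a b
    = (y == conf b)%:R * ((conf a \in Omega L N)%:R * mu q z y a 0).
  rewrite mxE big_ord1 /bra [_^T 0 b]mxE ketE /muN proj_diag mul_diag_mx.
  by move: (mu _ _ _) => v; rewrite !mxE mulrC eq_sym.
under eq_bigr do rewrite termE.
have [bK|bK] := boolP (conf b \in Omega L K); last first.
  rewrite mulr0 mul0r big1 // => y yK.
  case: eqP => [yb|]; last by rewrite mul0r.
  by rewrite -yb yK in bK.
rewrite (bigD1 (conf b)) // eqxx mul1r big1 => [|y /andP[_ /negbTE ->]];
  last by rewrite mul0r.
rewrite /= addr0 mulr1 muE //.
move: bK; rewrite mem_Omega => /eqP ->.
have [|_] := boolP (conf a \in Omega L N); last by rewrite !mul0r.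
by rewrite mem_Omega => /eqP ->; rewrite !mul1r.
Qed.

(** Off the sectors both sides vanish. On them the weights in [ring_duality] come from the particle
    number of the other configuration, which is why K and N trade places as boundary strengths. *)
Lemma Hbar_intertwine (w q z : R) (K N : nat) : (2 <= L)%N -> 0 < q ->
  Hbar L w q K N *m shock_kernel q z K N
  = shock_kernel q z K N *m Hbar L w q N K.
Proof.
move=> L2 q0; rewrite !HbarE //.
pose S : 'M[R]_dim := \matrix_(a, b) ((conf a \in Omega L N)%:R
  * (conf b \in Omega L K)%:R
  * (z^-1 ^+ K * z ^+ N * duality q (conf a) (conf b))).
have -> : shock_kernel q z K N = map_mx (real_complex R) S.
  by apply/matrixP => a b; rewrite shock_kernelE // !mxE.
rewrite -!map_mxM; congr map_mx; apply/matrixP => a b; rewrite !mxE.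
have [aN|aN] := boolP (conf a \in Omega L N); last first.
  by rewrite !big1 // => c _; rewrite !mxE (negbTE aN) !mul0r.
have [bK|bK] := boolP (conf b \in Omega L K); last first.
  by rewrite !big1 // => c _; rewrite !mxE (negbTE bK) !(mulr0, mul0r).
pose g := - w * (z^-1 ^+ K * z ^+ N).
transitivity (g * \sum_xi ring_rates q K (conf a) xi * duality q xi (conf b)).
  rewrite mulr_sumr -sum_conf; apply: eq_bigr => c _.
  rewrite !mxE aN bK; have [cN|cN] := boolP (conf c \in Omega L N).
    by rewrite /g /=; ring.
  (* Outside the sector the projector kills one term and particle conservation the other. *)
  rewrite ring_rates_occ ?(mul0r, mulr0) //.
  by move: aN cN; rewrite !mem_Omega => /eqP ->; rewrite eq_sym.
have KE : #|occ (conf b)| = K by apply/eqP; rewrite -mem_Omega.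
have NE : #|occ (conf a)| = N by apply/eqP; rewrite -mem_Omega.
rewrite -{1}KE ring_duality // NE mulr_sumr -sum_conf; apply: eq_bigr => c _.
rewrite !mxE aN bK; have [cN|cN] := boolP (conf c \in Omega L K).
  by rewrite /g /=; ring.
rewrite ring_rates_occ ?(mul0r, mulr0) //.
by move: bK cN; rewrite !mem_Omega => /eqP ->.
Qed.

End Operators.

Theorem theorem3 (R : realType) (L : nat) (hL : (2 <= L)%N)
  (q w z : R) (hq0 : 0 < q) (hq1 : q != 1) (hw : w != 0) (hz : 0 < z)
  (x : config L) (N : nat) (hN : (N <= L)%N) (t : R) (ht : 0 <= t) :
  muN_t w q z N x t =
  \sum_(y in Omega L #|occ x|) Pbar w q N y t x *: muN q z N y.
Proof.
set K := #|occ x|.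
have xK : x \in Omega L K by rewrite mem_Omega.
(* The initial measure is the kernel applied to |x>, so the exponential can be moved across the
   kernel. *)
rewrite /muN_t -(shock_kernel_ket q z N xK) mulmxA -/K.
have realE M' N' : - (t%:C *: Hbar L w q M' N')
    = map_mx (real_complex R) (- (t *: Hbar_real L w q M' N')).
  by rewrite HbarE // -map_mxZ -map_mxN.
rewrite realE (expm_intertwine (B := - (t *: Hbar_real L w q N K))) -!realE;
  last first.
  by rewrite mulNmx mulmxN -scalemxAl -scalemxAr Hbar_intertwine.
(* Each term of the kernel now ends in <y| applied to the evolved |x>, a 1 x 1 matrix with entry
   [Pbar]. *)
rewrite /shock_kernel -mulmxA mulmx_suml; apply: eq_bigr => y _.
rewrite -mulmxA -[RHS]mul_mx_scalar; congr (_ *m _).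
apply/matrixP => i j; rewrite !ord1 [RHS]mxE eqxx mulr1n /Pbar -/K.
by rewrite mulmxA.
Qed.
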